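(* Let $n\ge 1$ be an integer and let $s(m)=0$ if $m$ is even and $s(m)=*$ if $m$ is odd. The canonical form of \textsc{Snort} played on the (untinted) caterpillar $C(n+1,n,n+1)$ is \[\pm \Big\{\, 2n+1+s(n),\ \big\{ \{ 3n+2 \mid 2n+2+s(n-1) \} \ \big|\ s(n) \big\} \,\Big\},\] i.e. the game whose Left options are $2n+1+s(n)$ and $\big\{ \{ 3n+2 \mid 2n+2+s(n-1) \} \mid s(n) \big\}$ and whose Right options are the negatives of these.
   Context: \textsc{Snort} is a two-player normal-play combinatorial game (the player unable to move loses) between Left (blue) and Right (red), played on a finite simple graph; players alternately colour an uncoloured vertex in their own colour, and a player may not colour a vertex adjacent to a vertex coloured by the opponent. Game values are in the standard sense of combinatorial game theory: $\{A\mid B\}$ is the game with Left options $A$ and Right options $B$, $*=\{0\mid 0\}$, integers are the usual integer games, $\pm\{A,B\}$ denotes $\{A,B\mid -A,-B\}$, and the canonical form is the unique simplest game equal to the given one (no dominated or reversible options). The caterpillar $C(n+1,n,n+1)$ has vertex set $\{a,b,c,a_1,\dots,a_{n+1},b_1,\dots,b_n,c_1,\dots,c_{n+1}\}$ and edge set $\{ab,bc\}\cup\{a_ia, c_ic : 1\le i\le n+1\}\cup\{b_jb : 1\le j\le n\}$. *)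

(* Defs.v *)
From mathcomp Require Import all_boot.
Set Implicit Arguments. Unset Strict Implicit. Unset Printing Implicit Defensive.

Inductive game : Type := Gm : seq game -> seq game -> game.

Definition leftg (g : game) : seq game := let: Gm L _ := g in L.
Definition rightg (g : game) : seq game := let: Gm _ R := g in R.

Fixpoint depth (g : game) : nat :=
  let: Gm L R := g in (maxn (foldr maxn 0 (map depth L)) (foldr maxn 0 (map depth R))).+1.

(** G <= H  iff  no G^L with H <= G^L  and no H^R with H^R <= G.
    Computed with fuel; fuel depth g + depth h always suffices. *)
Fixpoint lef (k : nat) (g h : game) : bool :=
  match k with
  | 0 => true
  | k'.+1 =>
    let: Gm gl _ := g in let: Gm _ hr := h in
    all (fun x => ~~ lef k' h x) gl && all (fun y => ~~ lef k' y g) hr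
  end.

Definition le (g h : game) : bool := lef (depth g + depth h) g h.
Definition eqv (g h : game) : Prop := le g h /\ le h g.

Fixpoint negg (g : game) : game :=
  let: Gm L R := g in Gm (map negg R) (map negg L).

Fixpoint add (g : game) : game -> game :=
  fix addg (h : game) : game :=
    let: Gm gl gr := g in let: Gm hl hr := h in
    Gm (map (fun x => add x h) gl ++ map addg hl)
       (map (fun x => add x h) gr ++ map addg hr).

Fixpoint ofnat (k : nat) : game :=
  match k with 0 => Gm [::] [::] | k'.+1 => Gm [:: ofnat k'] [::] end.

Definition zerog : game := Gm [::] [::].
Definition starg : game := Gm [:: zerog] [:: zerog].

Definition sgame (m : nat) : game := if odd m then starg else zerog.

Definition dominatedL (L : seq game) : Prop :=
  exists i j, i < size L /\ j < size L /\ i <> j /\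
    le (nth zerog L i) (nth zerog L j).
Definition dominatedR (R : seq game) : Prop :=
  exists i j, i < size R /\ j < size R /\ i <> j /\
    le (nth zerog R j) (nth zerog R i).

(** list membership (game has no eqType) *)
Fixpoint memg (x : game) (l : seq game) : Prop :=
  match l with [::] => False | y :: l' => x = y \/ memg x l' end.

Definition reversibleL (g : game) : Prop :=
  exists x, memg x (leftg g) /\ exists y, memg y (rightg x) /\ le y g.
Definition reversibleR (g : game) : Prop :=
  exists x, memg x (rightg g) /\ exists y, memg y (leftg x) /\ le g y.

Fixpoint canon (g : game) : Prop :=
  let: Gm L R := g in
  (fix allc (l : seq game) : Prop :=
     match l with [::] => True | x :: l' => canon x /\ allc l' end) L
  /\ (fix allc (l : seq game) : Prop :=
     match l with [::] => True | x :: l' => canon x /\ allc l' end) R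
  /\ ~ dominatedL L /\ ~ dominatedR R
  /\ ~ reversibleL g /\ ~ reversibleR g.

(** * Snort on a finite simple graph (T, e).
    A position assigns to each vertex None (uncoloured), Some true (blue, Left)
    or Some false (red, Right). *)
Section Snort.
Variables (T : finType) (e : rel T).

Definition legal (f : {ffun T -> option bool}) (v : T) (c : bool) : bool :=
  (f v == None) && [forall u, e u v ==> (f u != Some (~~ c))].

Definition upd (f : {ffun T -> option bool}) (v : T) (c : bool)
  : {ffun T -> option bool} := [ffun x => if x == v then Some c else f x].

(** fuel k = number of uncoloured vertices *)
Fixpoint snort_aux (k : nat) (f : {ffun T -> option bool}) : game :=
  match k with
  | 0 => Gm [::] [::]
  | k'.+1 =>
    Gm [seq snort_aux k' (upd f v true) | v <- enum T & legal f v true]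
       [seq snort_aux k' (upd f v false) | v <- enum T & legal f v false]
  end.

Definition snort : game := snort_aux #|T| [ffun=> None].
End Snort.

(** * The caterpillar C(n+1, n, n+1).
    Vertices: inl(inl(inl i)) for i in 'I_3 are a (0), b (1), c (2);
    inl(inl(inr i)) are a_1..a_{n+1}; inl(inr j) are b_1..b_n;
    inr i are c_1..c_{n+1}. *)
Definition cat_V (n : nat) : finType := ((('I_3 + 'I_n.+1) + 'I_n) + 'I_n.+1)%type.

Definition cat_adj0 (n : nat) (x y : cat_V n) : bool :=
  match x, y with
  | inl (inl (inl i)), inl (inl (inl j)) =>
      ((i == 0 :> nat) && (j == 1 :> nat)) || ((i == 1 :> nat) && (j == 2 :> nat))
  | inl (inl (inr _)), inl (inl (inl j)) => j == 0 :> nat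
  | inl (inr _), inl (inl (inl j)) => j == 1 :> nat
  | inr _, inl (inl (inl j)) => j == 2 :> nat
  | _, _ => false
  end.

Definition cat_adj (n : nat) : rel (cat_V n) :=
  fun x y => cat_adj0 x y || cat_adj0 y x.

(* Main.v *)
Require Import Defs.
From mathcomp Require Import all_boot perm order ssralg ssrnum ssrint zify.
Set Implicit Arguments. Unset Strict Implicit. Unset Printing Implicit Defensive.

(** A position is determined by the set of vertices that Left may still colour
    and the set that Right may still colour. When no edge joins these two sets
    the game is an integer, possibly plus star, that can be read off the
    cardinalities. Colouring a centre dominates colouring any of its leaves,
    because exchanging the two vertices maps one resulting position into the
    other. So only the moves at [a], [b], [c] matter: after Left plays [b] the
    game equals [2n+1+s(n)], after [a] (or, by reflection, [c]) it equals
    [{{3n+2 | 2n+2+s(n-1)} | s(n)}], and every comparison needed along the way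
    ends in edge-free positions. Since both the caterpillar and the claimed
    game are their own negatives, one of the two inequalities is enough. *)

(** * Option lists and the order on games *)

Lemma memg_map (S : eqType) (F : S -> game) (y : game) (s : seq S) :
  memg y (map F s) <-> exists2 x, x \in s & y = F x.
Proof.
elim: s => [|z s IH] /=; first by split=> // -[].
rewrite IH; split=> [[->|[x xs ->]]|[x]].
- by exists z; rewrite ?mem_head.
- by exists x; rewrite // inE xs orbT.
- by rewrite inE => /predU1P[-> ->|xs ->]; [left | right; exists x].
Qed.

Lemma memg_mapg (F : game -> game) (y : game) (s : seq game) :
  memg y (map F s) <-> exists2 x, memg x s & y = F x.
Proof.
elim: s => [|z s IH] /=; first by split=> // -[].
rewrite IH; split=> [[->|[x xs ->]]|[x [->|xs] ->]]; first by exists z; [left|].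
- by exists x; [right|].
- by left.
- by right; exists x.
Qed.

Lemma allg (p : pred game) (l : seq game) :
  reflect (forall x, memg x l -> p x) (all p l).
Proof.
elim: l => [|z l IH] /=; first exact: ReflectT.
apply: (iffP andP) => [[pz /IH pl] x [-> //|/pl //]|pl].
by split; [apply: pl; left | apply/IH => x xl; apply: pl; right].
Qed.

Lemma leq_foldr_maxn (f : game -> nat) (l : seq game) (x : game) :
  memg x l -> f x <= foldr maxn 0 (map f l).
Proof. by elim: l => //= z l IH [->|/IH]; rewrite leq_max ?leqnn // => ->; rewrite orbT. Qed.

Lemma depth_left (g x : game) : memg x (leftg g) -> depth x < depth g.
Proof. by case: g => L R /= /(leq_foldr_maxn depth); rewrite ltnS leq_max => ->. Qed.

Lemma depth_right (g x : game) : memg x (rightg g) -> depth x < depth g.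
Proof. by case: g => L R /= /(leq_foldr_maxn depth); rewrite ltnS leq_max orbC => ->. Qed.

Lemma lefE (k : nat) (g h : game) : lef k.+1 g h =
  all (fun x => ~~ lef k h x) (leftg g) && all (fun y => ~~ lef k y g) (rightg h).
Proof. by case: g; case: h. Qed.

Lemma eq_all_memg (p q : pred game) (l : seq game) :
  (forall x, memg x l -> p x = q x) -> all p l = all q l.
Proof.
elim: l => //= z l IH pq; rewrite pq; last by left.
by rewrite IH // => x xl; apply: pq; right.
Qed.

(** Every depth is positive, so under these bounds the default answer at fuel [0] is never reached.
    A recursive call replaces one of the two games by an option, which lowers the sum of the
    depths. *)
Lemma lef_fuel (k k' : nat) (g h : game) :
  depth g + depth h <= k -> depth g + depth h <= k' -> lef k g h = lef k' g h.
Proof.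
elim: k k' g h => [|k IH] [|k'] g h; try by case: g => L R; rewrite /= addSn.
move=> gk gk'; rewrite !lefE; congr (_ && _); apply: eq_all_memg => x.
- by move/depth_left=> xg; congr (~~ _); apply: IH; lia.
- by move/depth_right=> xh; congr (~~ _); apply: IH; lia.
Qed.

Lemma leE (g h : game) : le g h =
  all (fun x => ~~ le h x) (leftg g) && all (fun y => ~~ le y g) (rightg h).
Proof.
(* One surplus unit of fuel exposes a single unfolding of the recursion. *)
have {1}->: le g h = lef (depth g + depth h).+1 g h by apply: lef_fuel; lia.
rewrite lefE; congr (_ && _); apply: eq_all_memg => x.
- by move/depth_left=> xg; congr (~~ _); apply: lef_fuel; lia.
- by move/depth_right=> xh; congr (~~ _); apply: lef_fuel; lia.
Qed.

Lemma leP (g h : game) :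
  reflect ((forall x, memg x (leftg g) -> ~~ le h x)
           /\ (forall y, memg y (rightg h) -> ~~ le y g)) (le g h).
Proof. by rewrite leE; apply: (iffP andP) => -[/allg Hl /allg Hr]. Qed.

Lemma nle_left (g h x : game) : memg x (leftg h) -> le g x -> ~~ le h g.
Proof. by move=> xh gx; apply/negP => /leP[/(_ x xh)]; rewrite gx. Qed.

Lemma nle_right (g h y : game) : memg y (rightg g) -> le y h -> ~~ le h g.
Proof. by move=> yg yh; apply/negP => /leP[_ /(_ y yg)]; rewrite yh. Qed.

Lemma le_refl (g : game) : le g g.
Proof.
move: {2}(depth g).+1 (ltnSn (depth g)) => k; elim: k g => // k IH g gk.
apply/leP; split=> x xg.
- by apply: (nle_left xg); apply: IH; move/depth_left: xg; lia.
- by apply: (nle_right xg); apply: IH; move/depth_right: xg; lia.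
Qed.

(** If a Left option [x] of [g] had [k <= x], then [h <= k <= x] would give [h <= x] by induction on
    the sum of depths, against [g <= h]. Right options of [k] are symmetric. *)
Lemma le_trans (h g k : game) : le g h -> le h k -> le g k.
Proof.
move: {2}(_ + _ + _).+1 (ltnSn (depth g + depth h + depth k)) => m.
elim: m g h k => // m IH g h k Hm gh hk; apply/leP; split=> x xg.
- apply/negP => kx; case/leP: gh => /(_ x xg) + _.
  by rewrite (IH h k x) //; move/depth_left: xg; lia.
- apply/negP => kx; case/leP: hk => _ /(_ x xg).
  by rewrite (IH x g h) //; move/depth_right: xg; lia.
Qed.

(** * Negation *)

Lemma leftg_neg (g : game) : leftg (negg g) = map negg (rightg g).
Proof. by case: g. Qed.

Lemma rightg_neg (g : game) : rightg (negg g) = map negg (leftg g).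
Proof. by case: g. Qed.

Lemma le_neg (g h : game) : le (negg g) (negg h) = le h g.
Proof.
move: {2}(_ + _).+1 (ltnSn (depth g + depth h)) => m.
elim: m g h => // m IH g h Hm.
rewrite !(leE _ (negg _)) leE leftg_neg rightg_neg !all_map andbC.
by congr (_ && _); apply: eq_all_memg => x /= xg; rewrite IH //;
   move: (@depth_left h x) (@depth_right g x); intuition lia.
Qed.

Lemma map_negK (l : seq game) :
  (forall x, memg x l -> negg (negg x) = x) -> map negg (map negg l) = l.
Proof.
elim: l => //= z l IH H; rewrite H; last by left.
by rewrite IH // => x xl; apply: H; right.
Qed.

Lemma neggK : involutive negg.
Proof.
move=> g; move: {2}(depth g).+1 (ltnSn (depth g)) => k.
elim: k g => // k IH [L R] gk /=; congr Gm; apply: map_negK => x xg; apply: IH.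
- by move: (@depth_left (Gm L R) x xg); lia.
- by move: (@depth_right (Gm L R) x xg); lia.
Qed.

(** * Canonical forms and their negatives *)

Lemma canonE (L R : seq game) : canon (Gm L R) <->
  [/\ forall x, memg x L -> canon x, forall x, memg x R -> canon x
    & [/\ ~ dominatedL L, ~ dominatedR R,
          ~ reversibleL (Gm L R) & ~ reversibleR (Gm L R)]].
Proof.
have allcE (l : seq game) :
  (fix allc (l : seq game) : Prop :=
     match l with [::] => True | x :: l' => canon x /\ allc l' end) l
  <-> forall x, memg x l -> canon x.
  elim: l => [|z l IH]; first by split.
  split=> [[cz /IH cl] x [->//|/cl //]|cl].
  by split; [apply: cl; left | apply/IH => x xl; apply: cl; right].
rewrite [canon _]/=; split.
- by move=> [/allcE ? [/allcE ? [? [? [? ?]]]]].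
- by move=> [? ? [? ? ? ?]]; do !split=> //; apply/allcE.
Qed.

Lemma dominatedL_neg (L : seq game) : dominatedL (map negg L) -> dominatedR L.
Proof.
move=> [i [j [iL [jL [ij]]]]]; rewrite size_map in iL jL.
change zerog with (negg zerog); rewrite !(nth_map zerog) // le_neg.
by exists i, j.
Qed.

Lemma dominatedR_neg (L : seq game) : dominatedR (map negg L) -> dominatedL L.
Proof.
move=> [i [j [iL [jL [ij]]]]]; rewrite size_map in iL jL.
change zerog with (negg zerog); rewrite !(nth_map zerog) // le_neg.
by exists i, j.
Qed.

Lemma reversibleL_neg (g : game) : reversibleL (negg g) -> reversibleR g.
Proof.
move=> [x []]; rewrite leftg_neg => /memg_mapg[x' xg ->] [y []].
rewrite rightg_neg => /memg_mapg[y' yx ->]; rewrite le_neg => gy.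
by exists x'; split=> //; exists y'.
Qed.

Lemma reversibleR_neg (g : game) : reversibleR (negg g) -> reversibleL g.
Proof.
move=> [x []]; rewrite rightg_neg => /memg_mapg[x' xg ->] [y []].
rewrite leftg_neg => /memg_mapg[y' yx ->]; rewrite le_neg => gy.
by exists x'; split=> //; exists y'.
Qed.

Lemma canon_neg (g : game) : canon g -> canon (negg g).
Proof.
move: {2}(depth g).+1 (ltnSn (depth g)) => k.
elim: k g => // k IH [L R] gk /canonE[cL cR [dL dR rL rR]].
have [gL gR] := (@depth_left (Gm L R), @depth_right (Gm L R)).
apply/canonE; split.
- by move=> _ /memg_mapg[x xR ->]; apply: IH (cR _ xR); move: (gR _ xR); lia.
- by move=> _ /memg_mapg[x xL ->]; apply: IH (cL _ xL); move: (gL _ xL); lia.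
split.
- by move/dominatedL_neg.
- by move/dominatedR_neg.
- by move/(@reversibleL_neg (Gm L R)).
- by move/(@reversibleR_neg (Gm L R)).
Qed.

Lemma singleton_dominatedL (g : game) : ~ dominatedL [:: g].
Proof. by move=> [i [j [/= i1 [j1 [ij _]]]]]; lia. Qed.

Lemma singleton_dominatedR (g : game) : ~ dominatedR [:: g].
Proof. by move=> [i [j [/= i1 [j1 [ij _]]]]]; lia. Qed.

Lemma pair_dominatedL (g h : game) : ~~ le g h -> ~~ le h g -> ~ dominatedL [:: g; h].
Proof.
move=> /negP gh /negP hg [i [j [/= i2 [j2 [ij]]]]].
by case: i j i2 j2 ij => [|[|i]] [|[|j]] //=; lia.
Qed.

(** * Integers and integers plus star *)

Definition ofint (z : int) : game :=
  match z with Posz m => ofnat m | Negz m => negg (ofnat m.+1) end.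

(** [numg z true] is the canonical form of [z + *]. *)
Definition numg (z : int) (star : bool) : game :=
  if star then Gm [:: ofint z] [:: ofint z] else ofint z.

Lemma PoszS_pred (m : nat) : (Posz m.+1 - 1)%R = Posz m.
Proof. lia. Qed.

Lemma NegzS_succ (m : nat) : (Negz m.+1 + 1)%R = Negz m.
Proof. lia. Qed.

Lemma left_numg (z : int) (b : bool) (x : game) : memg x (leftg (numg z b)) ->
  if b then x = numg z false else (0 < z)%R /\ x = numg (z - 1)%R false.
Proof.
case: b => [[]|] //; case: z => [[|m]|m] // [] // ->.
by rewrite PoszS_pred.
Qed.

Lemma right_numg (z : int) (b : bool) (x : game) : memg x (rightg (numg z b)) ->
  if b then x = numg z false else (z < 0)%R /\ x = numg (z + 1)%R false.
Proof.
case: b => [[]|] //; case: z => [[|m]|[|m]] // [] // ->.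
by rewrite NegzS_succ.
Qed.

Lemma numg_left (z : int) : memg (numg z false) (leftg (numg z true)).
Proof. by left. Qed.

Lemma numg_right (z : int) : memg (numg z false) (rightg (numg z true)).
Proof. by left. Qed.

Lemma int_left (z : int) : (0 < z)%R -> memg (numg (z - 1)%R false) (leftg (numg z false)).
Proof. by case: z => [[|m]|m] // _; rewrite PoszS_pred; left. Qed.

Lemma int_right (z : int) : (z < 0)%R -> memg (numg (z + 1)%R false) (rightg (numg z false)).
Proof. by case: z => [m|[|m]] // _; rewrite ?NegzS_succ; left. Qed.

Lemma le_numg (x y : int) (a b : bool) :
  le (numg x a) (numg y b) = ((x < y)%R || ((x == y) && (a == b))).
Proof.
have [m] := ubnP (2 * absz x + a + 2 * absz y + b).
elim: m x y a b => // m IH x y a b Hm; apply/idP/idP.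
- apply: contraTT => xy.
  case: a b => [] [] in Hm xy *.
  + by apply: (nle_left (numg_left x)); rewrite IH; lia.
  + by apply: (nle_left (numg_left x)); rewrite IH; lia.
  + by apply: (nle_right (numg_right y)); rewrite IH; lia.
  (* Here [y < x]. Either [x] is positive and Left moves in it, or [y] is negative and Right moves
     in it. *)
  + case: (boolP (0 < x)%R) => x0; first by apply: (nle_left (int_left x0)); rewrite IH; lia.
    by apply: (@nle_right _ _ _ (int_right _)); rewrite ?IH; lia.
- move=> xy; apply/leP; split=> g.
  + by move/left_numg; case: a => [|] in Hm xy * => [->|[x0 ->]]; rewrite IH; lia.
  + by move/right_numg; case: b => [|] in Hm xy * => [->|[x0 ->]]; rewrite IH; lia.
Qed.

Lemma canon_numg (z : int) (b : bool) : canon (numg z b).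
Proof.
have canon_int (y : int) : canon (numg y false).
  have [m] := ubnP (absz y); elim: m y => // m IH y ym.
  case E: (numg y false) => [L R]; apply/canonE.
  have HL x : memg x L -> (0 < y)%R /\ x = numg (y - 1)%R false.
    by move=> xL; apply: (@left_numg y false); rewrite E.
  have HR x : memg x R -> (y < 0)%R /\ x = numg (y + 1)%R false.
    by move=> xL; apply: (@right_numg y false); rewrite E.
  split; [by move=> x /HL[y0 ->]; apply: IH; lia|by move=> x /HR[y0 ->]; apply: IH; lia|].
  split; rewrite -?E.
  - by case: y E {ym HL HR} => [[|k]|k] [<- _] //;
      [move=> [? [? []]] | exact: singleton_dominatedL | move=> [? [? []]]].
  - by case: y E {ym HL HR} => [[|k]|k] [_ <-] //;
      [move=> [? [? []]] | move=> [? [? []]] | exact: singleton_dominatedR].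
  (* A reversal would need [0 < y] for the Left option and [y - 1 < 0] for its Right option. *)
  - by move=> [x [/left_numg[y0 ->] [w [/right_numg[]]]]]; lia.
  - by move=> [x [/right_numg[y0 ->] [w [/left_numg[]]]]]; lia.
case: b => //; apply/canonE; split;
  [by move=> x [->|//]; exact: (canon_int z)|by move=> x [->|//]; exact: (canon_int z) | split].
- exact: singleton_dominatedL.
- exact: singleton_dominatedR.
(* The only candidate for a reversal is [z + 1], and it is not below [z + *]. *)
- move=> [x [[->|//] [w [/(@right_numg z false)[_ ->]]]]].
  by rewrite -/(numg z true) le_numg; lia.
- move=> [x [[->|//] [w [/(@left_numg z false)[_ ->]]]]].
  by rewrite -/(numg z true) le_numg; lia.
Qed.

(** * Adding star to an integer *)

Lemma add_zero (g : game) : add g zerog = g.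
Proof.
move: {2}(depth g).+1 (ltnSn (depth g)) => k.
elim: k g => // k IH [L R] gk.
have {}IH x : memg x L \/ memg x R -> add x zerog = x.
  by case=> [xL|xR]; apply: IH;
     [move: (@depth_left (Gm L R) x xL) | move: (@depth_right (Gm L R) x xR)]; lia.
rewrite /= !cats0; congr Gm; [move: (fun x xL => IH x (or_introl xL))
                             |move: (fun x xR => IH x (or_intror xR))].
- by elim: {IH gk} L => //= x L IHL IH; rewrite IH ?IHL //; [move=> y yL; apply: IH; right | left].
- by elim: {IH gk} R => //= x R IHR IH; rewrite IH ?IHR //; [move=> y yR; apply: IH; right | left].
Qed.

(** For positive [m], the computed sum [m + *] has the extra Left option [(m - 1) + *]. It is
    harmless, being below [m + *] by the induction hypothesis. *)
Lemma eqv_numg_add (m k : nat) : eqv (numg m (odd k)) (add (ofnat m) (sgame k)).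
Proof.
rewrite /sgame; case: (odd k); last by rewrite add_zero; split; apply: le_refl.
rewrite [numg _ _]/(numg m true).
elim: m => [|m [IH1 IH2]]; first by split.
have E : add (ofnat m.+1) starg =
  Gm [:: add (ofnat m) starg; ofnat m.+1] [:: ofnat m.+1].
  rewrite /starg /=.
  have: add (ofnat m) zerog = ofnat m by apply: add_zero.
  by case: (ofnat m) => L R /= ->.
rewrite E; split; apply/leP; split=> x; rewrite [memg _ _]/=.
- by case=> // ->; apply: (@nle_left _ _ (ofnat m.+1)); [right; left | apply: le_refl].
- by case=> // ->; apply: (@nle_right _ _ (ofnat m.+1)); [left | apply: le_refl].
- case=> [->|[->|//]].
  + apply/negP => H; have: le (numg m.+1 true) (numg m true) := le_trans H IH2.
    by rewrite le_numg; lia.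
  + by apply: (@nle_left _ _ (ofnat m.+1)); [left | apply: le_refl].
- by case=> // ->; apply: (@nle_right _ _ (ofnat m.+1)); [left | apply: le_refl].
Qed.

(** * Snort positions *)

Section Positions.
Variables (T : finType) (e : rel T).
Hypothesis e_sym : symmetric e.
Implicit Types (p q : {set T} * {set T}) (u v x y : T).

(** [p.1] and [p.2] are the sets of vertices that Left and Right may still colour. *)
Definition nbh v : {set T} := [set u | (u == v) || e v u].
Definition lmove v p := (p.1 :\ v, p.2 :\: nbh v).
Definition rmove v p := (p.1 :\: nbh v, p.2 :\ v).

Fixpoint posn (k : nat) p : game :=
  if k is k'.+1 then
    Gm [seq posn k' (lmove v p) | v <- enum p.1] [seq posn k' (rmove v p) | v <- enum p.2]
  else zerog.

Definition live p := #|p.1 :|: p.2|.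
Definition pos p := posn (live p) p.

Lemma live_lmove v p : v \in p.1 -> live (lmove v p) < live p.
Proof.
move=> vp; apply: proper_card; apply/properP; split.
  by apply/subsetP=> u; rewrite !inE; case/orP=> /andP[_ ->]; rewrite ?orbT.
by exists v; rewrite !inE ?vp ?eqxx.
Qed.

Lemma live_rmove v p : v \in p.2 -> live (rmove v p) < live p.
Proof.
move=> vp; apply: proper_card; apply/properP; split.
  by apply/subsetP=> u; rewrite !inE; case/orP=> /andP[_ ->]; rewrite ?orbT.
by exists v; rewrite !inE ?vp ?eqxx ?orbT.
Qed.

Lemma posn_dead k p : live p = 0 -> posn k p = zerog.
Proof.
move/cards0_eq/setP=> p0; case: k => //= k.
have -> : p.1 = set0 by apply/setP => u; move: (p0 u); rewrite !inE => /norP[/negbTE].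
have -> : p.2 = set0 by apply/setP => u; move: (p0 u); rewrite !inE => /norP[_ /negbTE].
by rewrite enum_set0.
Qed.

Lemma posn_fuel k k' p : live p <= k -> live p <= k' -> posn k p = posn k' p.
Proof.
elim: k k' p => [|k IH] [|k'] p pk pk'; try by rewrite !posn_dead //; lia.
rewrite /=; congr Gm; apply/eq_in_map => v; rewrite mem_enum.
- by move/live_lmove=> vp; apply: IH; lia.
- by move/live_rmove=> vp; apply: IH; lia.
Qed.

Lemma posE p : pos p =
  Gm [seq pos (lmove v p) | v <- enum p.1] [seq pos (rmove v p) | v <- enum p.2].
Proof.
rewrite {1}/pos (@posn_fuel _ (live p).+1) //=; congr Gm; apply/eq_in_map => v;
  rewrite mem_enum.
- by move/live_lmove=> vp; apply: posn_fuel; lia.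
- by move/live_rmove=> vp; apply: posn_fuel; lia.
Qed.

Lemma left_pos p g : memg g (leftg (pos p)) <-> exists2 v, v \in p.1 & g = pos (lmove v p).
Proof.
by rewrite posE memg_map; split=> -[v vp ->]; exists v => //; move: vp; rewrite mem_enum.
Qed.

Lemma right_pos p g : memg g (rightg (pos p)) <-> exists2 v, v \in p.2 & g = pos (rmove v p).
Proof.
by rewrite posE memg_map; split=> -[v vp ->]; exists v => //; move: vp; rewrite mem_enum.
Qed.

Lemma nle_lmove v p g : v \in p.1 -> le g (pos (lmove v p)) -> ~~ le (pos p) g.
Proof. by move=> vp; apply: nle_left; apply/left_pos; exists v. Qed.

Lemma nle_rmove v p g : v \in p.2 -> le (pos (rmove v p)) g -> ~~ le g (pos p).
Proof. by move=> vp; apply: nle_right; apply/right_pos; exists v. Qed.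

Lemma pos_leP p g :
  (forall v, v \in p.1 -> ~~ le g (pos (lmove v p))) ->
  (forall y : game, memg y (rightg g) -> ~~ le y (pos p)) -> le (pos p) g.
Proof. by move=> pl gr; apply/leP; split=> // x /left_pos[v vp ->]; apply: pl. Qed.

Lemma le_posP p g :
  (forall v, v \in p.2 -> ~~ le (pos (rmove v p)) g) ->
  (forall x : game, memg x (leftg g) -> ~~ le (pos p) x) -> le g (pos p).
Proof. by move=> pr gl; apply/leP; split=> // x /right_pos[v vp ->]; apply: pr. Qed.

(** * From colourings to pairs of sets *)

Definition legal_pos (f : {ffun T -> option bool}) : {set T} * {set T} :=
  ([set v | legal e f v true], [set v | legal e f v false]).

Lemma legal_upd (f : {ffun T -> option bool}) v u (c c' : bool) : f v == None ->
  legal e (upd f v c) u c' = [&& legal e f u c', u != v & (c == c') || ~~ e v u].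
Proof.
move=> fv; rewrite /legal ffunE; case: (eqVneq u v) => [->|uv] /=.
  by rewrite andbF.
rewrite -andbA; congr (_ && _); apply/forallP/andP => [H|[/forallP H cc] w].
- split; last first.
    have:= H v; rewrite ffunE eqxx.
    by case: (e v u); rewrite ?orbT //=; case: c c' {H} => [] [].
  apply/forallP=> w; have := H w; rewrite ffunE; case: (eqVneq w v) => // -> _.
  (* Before the move [v] was uncoloured, so it put no constraint on [u]. *)
  by rewrite (eqP fv) implybT.
- rewrite ffunE; case: (eqVneq w v) => [->|_]; last exact: H.
  by move: cc; case: (e v u) => //=; case: c c' {H} => [] [].
Qed.

Lemma legal_posL f v : legal e f v true -> legal_pos (upd f v true) = lmove v (legal_pos f).
Proof.
case/andP=> fv _; congr pair; apply/setP=> u; rewrite !inE legal_upd //=;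
  by rewrite ?andbT ?negb_or andbC.
Qed.

Lemma legal_posR f v : legal e f v false -> legal_pos (upd f v false) = rmove v (legal_pos f).
Proof.
case/andP=> fv _; congr pair; apply/setP=> u; rewrite !inE legal_upd //=;
  by rewrite ?andbT ?negb_or andbC.
Qed.

(** From here on colours can be forgotten: the two sets of open vertices determine the whole game
    tree. *)
Lemma snort_auxE k f : snort_aux e k f = posn k (legal_pos f).
Proof.
have enum_setE (P : pred T) : enum [set v | P v] = [seq v <- enum T | P v].
  by rewrite [in RHS]enumT /enum_mem; apply: eq_filter => v; rewrite /= inE.
elim: k f => //= k IH f; rewrite !enum_setE; congr Gm; apply/eq_in_map => v;
  rewrite mem_filter => /andP[fv _]; rewrite IH.
- by rewrite legal_posL.
- by rewrite legal_posR.
Qed.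

Lemma snortE : snort e = pos (setT, setT).
Proof.
have -> : (setT, setT) = legal_pos [ffun=> None].
  by congr pair; apply/setP=> v; rewrite !inE /legal ffunE; apply/esym/forallP => u;
     rewrite ffunE implybT.
by rewrite /snort snort_auxE; apply: posn_fuel => //; apply: max_card.
Qed.

(** * Symmetry, comparison of positions and dominated moves *)

Lemma pos_neg p : negg (pos p) = pos (p.2, p.1).
Proof.
have [m] := ubnP (live p); elim: m p => // m IH p pm.
rewrite posE [RHS]posE /= -!map_comp; congr Gm; apply/eq_in_map => v; rewrite mem_enum /=.
- by move/live_rmove=> vp; rewrite IH //; lia.
- by move/live_lmove=> vp; rewrite IH //; lia.
Qed.

(** Left copies moves from [p] to [q] along [f], and Right's moves in [q] are pulled back to [p].
    Only edges between a vertex open to Left in [p] and one open to Right in [q] can influence this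
    play, so adjacency is compared on those pairs alone. *)
Lemma pos_mono (f : T -> T) p q : injective f ->
  {in p.1, forall v, f v \in q.1} ->
  (forall v, f v \in q.2 -> v \in p.2) ->
  (forall u v, v \in p.1 -> f u \in q.2 -> e v u = e (f v) (f u)) ->
  le (pos p) (pos q).
Proof.
move=> f_inj; have [m] := ubnP (live p + live q).
elim: m p q => // m IH p q pm pq1 pq2 pqe.
apply/leP; split=> g.
- move/left_pos=> [v vp ->]; have vq := pq1 v vp.
  apply: (nle_lmove vq); apply: IH.
  + by have := live_lmove vp; have := live_lmove vq; lia.
  + by move=> u; rewrite !inE (inj_eq f_inj) => /andP[-> /pq1].
  + move=> u; rewrite !inE (inj_eq f_inj) !negb_or => /andP[/andP[-> fuv] uq].
    by rewrite pqe // fuv pq2.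
  + by move=> u w; rewrite !inE => /andP[_ wp] /andP[_ uq]; apply: pqe.
- move/right_pos=> [w wq ->].
  (* On a finite type [f] is bijective, so Right's move in [q] has the form [f w]. *)
  have [f' fK f'K] := injF_bij f_inj; rewrite -(f'K w) in wq *.
  move: (f' w) wq => {}w wq; have wp := pq2 _ wq.
  apply: (nle_rmove wp); apply: IH.
  + by have := live_rmove wp; have := live_rmove wq; lia.
  + move=> v; rewrite !inE (inj_eq f_inj) !negb_or => /andP[/andP[-> ewv] vp].
    by rewrite e_sym -pqe // e_sym ewv pq1.
  + by move=> u; rewrite !inE (inj_eq f_inj) => /andP[-> /pq2].
  + by move=> u v; rewrite !inE => /andP[_ vp] /andP[_ uq]; apply: pqe.
Qed.

(** The transposition of [x] and [y] satisfies [pos_mono]: whatever stays open to Right after [y]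
    was also open after [x]. This covers a leaf [x] with centre [y], and also an [x] that is closed
    to Right and has no neighbour open to Right, against any other [y]. *)
Lemma lmove_dominated x y p : x \in p.1 -> y \in p.1 ->
  {in p.2, forall u, e x u -> u = y} -> (x \in p.2 -> e y x) ->
  le (pos (lmove x p)) (pos (lmove y p)).
Proof.
case: (eqVneq x y) => [-> *|xy]; first exact: le_refl.
move=> xp yp xN xy2; apply: (@pos_mono (tperm x y)); first exact: perm_inj.
- move=> v; rewrite !inE; case: tpermP => [->|->|/eqP vx /eqP vy] /=.
  + by rewrite eqxx.
  + by rewrite xy xp.
  + by rewrite vy => /andP[].
- move=> v; rewrite !inE; case: tpermP => [->|->|/eqP vx /eqP vy]; rewrite ?eqxx //=.
  + by rewrite (negPf xy) /= => /andP[eyx xp2]; rewrite xy2 in eyx.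
  + rewrite (negPf vx) (negPf vy) /= => /andP[eyv vp]; rewrite vp andbT.
    by apply/negP => exv; rewrite (xN _ vp exv) eqxx in vy.
- move=> u v; rewrite !inE => /andP[vx vp].
  case: (tpermP x y u) => [->|->|/eqP ux /eqP uy]; first by rewrite eqxx.
    by rewrite (negPf xy) /= => /andP[eyx xp2]; rewrite xy2 in eyx.
  rewrite (negPf uy) /= => /andP[eyu up].
  case: tpermP => [E|->|//]; first by rewrite E eqxx in vx.
  rewrite (negPf eyu); apply/esym/negP => exu.
  by rewrite (xN _ up exu) eqxx in uy.
Qed.

Lemma rmove_dominated x y p : x \in p.2 -> y \in p.2 ->
  {in p.1, forall u, e x u -> u = y} -> (x \in p.1 -> e y x) ->
  le (pos (rmove y p)) (pos (rmove x p)).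
Proof.
move=> xp yp xN xy; rewrite -le_neg !pos_neg.
exact: (@lmove_dominated x y (p.2, p.1)).
Qed.

(** * Edge-free positions *)

Definition edge_free p := {in p.1 & p.2, forall v u, ~~ e v u}.

(** Without edges the position is a disjoint sum in which a vertex open to both players is [*], and
    one open only to Left or only to Right is [1] or [-1]. The common vertices cancel in the
    difference of cardinalities, and the stars cancel in pairs. *)
Definition free_value p :=
  numg (Posz #|p.1| - Posz #|p.2|)%R (odd #|p.1 :&: p.2|).

Lemma edge_free_lmove v p : edge_free p -> edge_free (lmove v p).
Proof. by move=> ef w u; rewrite !inE => /andP[_ wp] /andP[_ up]; apply: ef. Qed.

Lemma edge_free_rmove v p : edge_free p -> edge_free (rmove v p).
Proof. by move=> ef w u; rewrite !inE => /andP[_ wp] /andP[_ up]; apply: ef. Qed.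

Lemma free_value_lmove v p : edge_free p -> v \in p.1 -> free_value (lmove v p) =
  numg (Posz #|p.1| - Posz #|p.2| - Posz (v \notin p.2))%R
    ((v \in p.2) (+) odd #|p.1 :&: p.2|).
Proof.
move=> ef vp; rewrite /free_value /=.
have -> : p.2 :\: nbh v = p.2 :\ v.
  apply/setP => u; rewrite !inE negb_or.
  by case up: (u \in p.2); rewrite ?andbF ?andbT // ef ?andbT.
have -> : (p.1 :\ v) :&: (p.2 :\ v) = (p.1 :&: p.2) :\ v.
  by apply/setP => u; rewrite !inE; case: (u != v); rewrite ?andbF.
have := cardsD1 v p.1; have := cardsD1 v p.2; have := cardsD1 v (p.1 :&: p.2).
rewrite inE vp /=; case: (v \in p.2) => /= -> -> ->; congr numg; lia.
Qed.

Lemma free_value_rmove v p : edge_free p -> v \in p.2 -> free_value (rmove v p) =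
  numg (Posz #|p.1| - Posz #|p.2| + Posz (v \notin p.1))%R
    ((v \in p.1) (+) odd #|p.1 :&: p.2|).
Proof.
move=> ef vp; rewrite /free_value /=.
have -> : p.1 :\: nbh v = p.1 :\ v.
  apply/setP => u; rewrite !inE negb_or.
  by case up: (u \in p.1); rewrite ?andbF ?andbT // e_sym ef ?andbT.
have -> : (p.1 :\ v) :&: (p.2 :\ v) = (p.1 :&: p.2) :\ v.
  by apply/setP => u; rewrite !inE; case: (u != v); rewrite ?andbF.
have := cardsD1 v p.1; have := cardsD1 v p.2; have := cardsD1 v (p.1 :&: p.2).
rewrite inE vp /=; case: (v \in p.1) => /= -> -> ->; congr numg; lia.
Qed.

Lemma pos_edge_free p : edge_free p -> eqv (pos p) (free_value p).
Proof.
have [m] := ubnP (live p); elim: m p => // m IH p pm ef.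
have IHl v (vp : v \in p.1) : eqv (pos (lmove v p)) (free_value (lmove v p)).
  by apply: IH; [have := live_lmove vp; lia | apply: edge_free_lmove].
have IHr v (vp : v \in p.2) : eqv (pos (rmove v p)) (free_value (rmove v p)).
  by apply: IH; [have := live_rmove vp; lia | apply: edge_free_rmove].
split; [apply: pos_leP => [v vp|y] | apply: le_posP => [v vp|y]].
- apply/negP => H; have := le_trans H (IHl v vp).1.
  by rewrite free_value_lmove // le_numg; case: (v \in p.2); lia.
- rewrite /free_value => /right_numg; case: ifP => [o ->|o [neg ->]].
  (* The star comes from an odd, hence nonzero, number of common vertices; Right colours one of
     them. *)
  + have /card_gt0P[v] : 0 < #|p.1 :&: p.2| by lia.
    rewrite inE => /andP[vp1 vp2]; apply: (nle_rmove vp2).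
    apply: (le_trans (IHr v vp2).1); rewrite free_value_rmove // vp1 le_numg; lia.
  (* A negative integer part forces a vertex that only Right may colour. *)
  + have /card_gt0P[v] : 0 < #|p.2 :\: p.1|.
      by rewrite cardsD; have := subset_leq_card (subsetIl p.1 p.2); rewrite setIC; lia.
    rewrite inE => /andP[vp1 vp2]; apply: (nle_rmove vp2).
    apply: (le_trans (IHr v vp2).1); rewrite free_value_rmove // (negPf vp1) le_numg; lia.
- apply/negP => H; have := le_trans (IHr v vp).2 H.
  by rewrite free_value_rmove // le_numg; case: (v \in p.1); lia.
- rewrite /free_value => /left_numg; case: ifP => [o ->|o [neg ->]].
  + have /card_gt0P[v] : 0 < #|p.1 :&: p.2| by lia.
    rewrite inE => /andP[vp1 vp2]; apply: (nle_lmove vp1).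
    apply: (le_trans _ (IHl v vp1).2); rewrite free_value_lmove // vp2 le_numg; lia.
  + have /card_gt0P[v] : 0 < #|p.1 :\: p.2|.
      by rewrite cardsD; have := subset_leq_card (subsetIr p.1 p.2); lia.
    rewrite inE => /andP[vp1 vp2]; apply: (nle_lmove vp2).
    apply: (le_trans _ (IHl v vp2).2); rewrite free_value_lmove // (negPf vp1) le_numg; lia.
Qed.

(** Closing every vertex to Right can only help Left, and leaves the integer that counts Left's
    vertices. *)
Lemma pos_le_card p : le (pos p) (ofnat #|p.1|).
Proof.
have ef : edge_free (p.1, set0) by move=> v u; rewrite inE.
have [H _] := pos_edge_free ef; move: H.
rewrite /free_value /= setI0 !cards0 GRing.subr0 => H; apply: (le_trans _ H).
by apply: (@pos_mono id) => //= v; rewrite inE.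
Qed.
End Positions.

(** * The caterpillar *)

Section Caterpillar.
Variable n : nat.
Implicit Types (u v : cat_V n).

Definition va : cat_V n := inl (inl (inl (@Ordinal 3 0 isT))).
Definition vb : cat_V n := inl (inl (inl (@Ordinal 3 1 isT))).
Definition vc : cat_V n := inl (inl (inl (@Ordinal 3 2 isT))).
Definition la (i : 'I_n.+1) : cat_V n := inl (inl (inr i)).
Definition lb (j : 'I_n) : cat_V n := inl (inr j).
Definition lc (i : 'I_n.+1) : cat_V n := inr i.

Lemma cat_ind (P : cat_V n -> Prop) : P va -> P vb -> P vc ->
  (forall i, P (la i)) -> (forall j, P (lb j)) -> (forall i, P (lc i)) -> forall v, P v.
Proof.
move=> Pa Pb Pc Pla Plb Plc [[[[m m3]|i]|j]|i]; [|exact: Pla|exact: Plb|exact: Plc].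
case: m m3 => [|[|[|m]]] m3; rewrite ?(bool_irrelevance m3 isT) //.
Qed.

(** Kind and index as natural numbers: kinds 0, 1, 2 are the centres [a], [b], [c], and 3, 4, 5
    their leaves. Equality and adjacency of vertices then reduce by computation. *)
Definition tagv v : nat * nat :=
  match v with
  | inl (inl (inl i)) => (nat_of_ord i, 0)
  | inl (inl (inr i)) => (3, nat_of_ord i)
  | inl (inr j) => (4, nat_of_ord j)
  | inr i => (5, nat_of_ord i)
  end.

Lemma tagvE u v : (u == v) = ((tagv u).1 == (tagv v).1) && ((tagv u).2 == (tagv v).2).
Proof.
apply/eqP/andP => [->//|[/eqP + /eqP]].
by elim/cat_ind: u => [|||i|i|i]; elim/cat_ind: v => [|||j|j|j] //= _ /ord_inj->.
Qed.

Definition adjk (x y : nat) : bool :=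
  match x, y with
  | 0, 1 | 1, 0 | 1, 2 | 2, 1 | 0, 3 | 3, 0 | 1, 4 | 4, 1 | 2, 5 | 5, 2 => true
  | _, _ => false
  end.

Lemma cat_adjE u v : cat_adj u v = adjk (tagv u).1 (tagv v).1.
Proof. by elim/cat_ind: u; elim/cat_ind: v. Qed.

Lemma cat_adj_sym : symmetric (@cat_adj n).
Proof. by move=> u v; rewrite /cat_adj orbC. Qed.

(** * Counting vertices by kind *)

Lemma card_cat (A : {set cat_V n}) : #|A| = (va \in A) + (vb \in A) + (vc \in A) +
  \sum_(i < n.+1) (la i \in A) + \sum_(j < n) (lb j \in A) + \sum_(i < n.+1) (lc i \in A).
Proof.
have E3 (F : 'I_3 -> nat) :
    \sum_(i < 3) F i = F (@Ordinal 3 0 isT) + F (@Ordinal 3 1 isT) + F (@Ordinal 3 2 isT).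
  by rewrite !big_ord_recl big_ord0 addn0 addnA; congr (F _ + F _ + F _); apply: val_inj.
have -> : #|A| = \sum_v (v \in A) by rewrite -sum1_card big_mkcond.
by rewrite !big_sumType E3.
Qed.

Lemma card_cat_eq (A : {set cat_V n}) (a b c x y z k : nat) :
  va \in A = a :> nat -> vb \in A = b :> nat -> vc \in A = c :> nat ->
  \sum_(i < n.+1) (la i \in A) = x -> \sum_(j < n) (lb j \in A) = y ->
  \sum_(i < n.+1) (lc i \in A) = z -> a + b + c + x + y + z = k -> #|A| = k.
Proof. by rewrite card_cat => -> -> -> -> -> ->. Qed.

Lemma eq_sum m (F F' : 'I_m -> nat) (k : nat) :
  (forall i, F i = F' i) -> \sum_(i < m) F' i = k -> \sum_(i < m) F i = k.
Proof. by move=> FF' <-; apply: eq_bigr. Qed.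

Lemma sum_neq m (k : 'I_m) : \sum_(i < m) ((i : nat) != k) = m.-1.
Proof.
have -> : \sum_(i < m) ((i : nat) != k : nat) = \sum_(i < m | i != k) 1.
  by rewrite [RHS]big_mkcond /=; apply: eq_bigr => i _; rewrite -val_eqE /=; case: (_ == _).
by rewrite sum1_card cardC1 card_ord.
Qed.

Lemma sum_true m : \sum_(i < m) true = m.
Proof. by rewrite sum_nat_const card_ord muln1. Qed.

Lemma sum_false m : \sum_(i < m) false = 0.
Proof. by rewrite sum_nat_const muln0. Qed.

Lemma sum_neq2 m (j k : 'I_m) : j != k ->
  \sum_(i < m) (((i : nat) != j) && ((i : nat) != k)) = m.-2.
Proof.
move=> jk; have -> : \sum_(i < m) (((i : nat) != j) && ((i : nat) != k) : nat)
    = \sum_(i in [set~ j] :\ k) 1.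
  rewrite [RHS]big_mkcond /=; apply: eq_bigr => i _.
  by rewrite !inE andbC -!val_eqE /=; case: (_ && _).
rewrite sum1_card; have := cardsD1 k [set~ j]; rewrite cardsC1 card_ord !inE eq_sym jk; lia.
Qed.

Local Notation lm := (lmove (@cat_adj n)).
Local Notation rm := (rmove (@cat_adj n)).
Local Notation pos := (pos (@cat_adj n)).

Lemma pos_eqv p (l r b : nat) (z : int) (s : bool) : edge_free (@cat_adj n) p ->
  #|p.1| = l -> #|p.2| = r -> #|p.1 :&: p.2| = b -> z = (Posz l - Posz r)%R -> s = odd b ->
  eqv (pos p) (numg z s).
Proof. by move=> ef <- <- <- -> ->; apply: (pos_edge_free cat_adj_sym). Qed.

Ltac cat_simpl := rewrite ?(inE, tagvE, cat_adjE) /= ?(andbT, andbF, orbF, andbb).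
Ltac cat_edges := let u := fresh in let v := fresh in
  move=> u v; rewrite !(inE, tagvE, cat_adjE);
  elim/cat_ind: u => [|||?|?|?]; elim/cat_ind: v => [|||?|?|?]; rewrite /= ?andbF //.
Ltac cat_sum := eapply eq_sum;
  [ move=> ?; cat_simpl; reflexivity
  | rewrite ?(sum_neq, sum_true, sum_false); reflexivity ].
Ltac cat_count := apply: card_cat_eq; [cat_simpl|cat_simpl|cat_simpl|cat_sum|cat_sum|cat_sum|];
 try reflexivity; rewrite ?(sum_neq, sum_true, sum_false); try lia.
(** The arguments are the numbers of vertices open to Left, to Right and to both. *)
Ltac cat_free l r b := apply: (@pos_eqv _ l r b);
  [cat_edges | cat_count | cat_count | cat_count | lia | lia].

Local Notation P0 := ([set: cat_V n], [set: cat_V n]).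
Local Notation Pa := (lm va P0).
Local Notation Pb := (lm vb P0).
Local Notation Pc := (lm vc P0).
Local Notation Pac := (lm vc Pa).
Local Notation Pab := (lm vb Pa).

(** Names list the moves in order: [Pb_la_c] is reached by Left at [b], Right at a
    leaf of [a], Left at [c]. *)
Lemma Pba_lc i : eqv (pos (rm (lc i) (lm va Pb))) (numg (Posz (2 * n + 1)) (odd n)).
Proof. cat_free (3 * n + 1) n n. Qed.

Lemma Pbc_la i : eqv (pos (rm (la i) (lm vc Pb))) (numg (Posz (2 * n + 1)) (odd n)).
Proof. cat_free (3 * n + 1) n n. Qed.

Lemma Pb_la_c i : eqv (pos (lm vc (rm (la i) Pb))) (numg (Posz (2 * n + 1)) (odd n)).
Proof. cat_free (3 * n + 1) n n. Qed.

Lemma Pb_lc_a i : eqv (pos (lm va (rm (lc i) Pb))) (numg (Posz (2 * n + 1)) (odd n)).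
Proof. cat_free (3 * n + 1) n n. Qed.

Lemma Pbac : eqv (pos (lm vc (lm va Pb))) (numg (Posz (3 * n + 2)) false).
Proof. cat_free (3 * n + 2) 0 0. Qed.

Lemma Pacb : eqv (pos (lm vb Pac)) (numg (Posz (3 * n + 2)) false).
Proof. cat_free (3 * n + 2) 0 0. Qed.

Lemma Pa_c : eqv (pos (rm vc Pa)) (numg 0 (odd n)).
Proof. cat_free (2 * n + 1) (2 * n + 1) n. Qed.

Lemma Pab_lc i : eqv (pos (rm (lc i) Pab)) (numg (Posz (2 * n + 1)) (odd n)).
Proof. cat_free (3 * n + 1) n n. Qed.

Lemma Pac_lb j : eqv (pos (rm (lb j) Pac)) (numg (Posz (2 * n + 2)) (odd n.-1)).
(* The index [j] forces [n] to be positive, so [n.-1] is not truncated. *)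
Proof. have jn := ltn_ord j. cat_free (3 * n + 1) n.-1 n.-1. Qed.

Lemma Pa_lb_c j : eqv (pos (lm vc (rm (lb j) Pa))) (numg (Posz (2 * n + 2)) (odd n.-1)).
Proof. have jn := ltn_ord j. cat_free (3 * n + 1) n.-1 n.-1. Qed.

(** Refutes a second leaf of [a] as Left's reply in [Pb_la_le]. The star is there for every [n],
    because [2n - 1] common vertices remain. *)
Lemma Pb_la_la_lc i j k : 0 < n -> i != j ->
  eqv (pos (rm (lc k) (lm (la j) (rm (la i) Pb)))) (numg (Posz n) true).
Proof.
move=> n0 ij; rewrite eq_sym in ij.
apply: (@pos_eqv _ (3 * n).-1 (2 * n).-1 (2 * n).-1); 
  [cat_edges | cat_count | cat_count | cat_count | lia | lia];
  by rewrite (sum_neq2 ij); lia.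
Qed.

Lemma nle_mono (a g h : game) : le g h -> ~~ le a h -> ~~ le a g.
Proof. by move=> gh; apply: contra => /le_trans; apply. Qed.

Lemma nge_mono (a g h : game) : le h g -> ~~ le h a -> ~~ le g a.
Proof. by move=> hg; apply: contra; apply: le_trans. Qed.

Ltac cat_impossible := by cat_simpl.
(** Replaces the Left move under consideration by the dominating move [y]; [cat_rdom] does the same
    for Right. *)
Ltac cat_ldom y := apply: (@nle_mono _ _ _ (@lmove_dominated _ _ cat_adj_sym _ y _ _ _ _ _));
  [by cat_simpl | by cat_simpl |
   let u := fresh in move=> u; elim/cat_ind: u => [|||?|?|?]; cat_simpl; done | by cat_simpl | ].
Ltac cat_rdom y := apply: (@nge_mono _ _ _ (@rmove_dominated _ _ cat_adj_sym _ y _ _ _ _ _));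
  [by cat_simpl | by cat_simpl |
   let u := fresh in move=> u; elim/cat_ind: u => [|||?|?|?]; cat_simpl; done | by cat_simpl | ].

(** * Value after Left plays [b] *)

Hypothesis n_gt0 : 0 < n.

(** For odd [n] the value [2n+1+*] has the Right option [2n+1], which Right matches in [Pb] by
    colouring a leaf of [a]. Left's best reply [c] only gives [2n+1+*], which is not at least
    [2n+1]. *)
Lemma Pb_la_le i : odd n -> le (pos (rm (la i) Pb)) (numg (Posz (2 * n + 1)) false).
Proof.
move=> n_odd; apply: pos_leP => [v|y /right_numg[]//].
have Hc : ~~ le (numg (Posz (2 * n + 1)) false) (pos (lm vc (rm (la i) Pb))).
  by apply: (nle_mono (Pb_la_c i).1); rewrite le_numg; lia.
elim/cat_ind: v => [|||j|j|j].
- cat_impossible.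
- cat_impossible.
- by move=> _; exact: Hc.
(* After another leaf of [a], Right closes [c] through one of its leaves and brings the game down to
   [n + *]. *)
- move=> jP; have ij : i != j by move: jP; cat_simpl; rewrite eq_sym -val_eqE.
  apply: (@nle_rmove _ _ (lc ord0)); first by cat_simpl.
  by apply: le_trans (Pb_la_la_lc ord0 n_gt0 ij).1 _; rewrite le_numg; lia.
- by move=> jP; cat_ldom vc.
- by move=> jP; cat_ldom vc.
Qed.

Lemma Pb_eqv : eqv (pos Pb) (numg (Posz (2 * n + 1)) (odd n)).
Proof.
split; [apply: pos_leP => [v|y yA] | apply: le_posP => [v|x xA]].
- have Ha : ~~ le (numg (Posz (2 * n + 1)) (odd n)) (pos (lm va Pb)).
    by apply: (@nle_rmove _ _ (lc ord0)); [cat_simpl | exact: (Pba_lc _).1].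
  have Hc : ~~ le (numg (Posz (2 * n + 1)) (odd n)) (pos (lm vc Pb)).
    by apply: (@nle_rmove _ _ (la ord0)); [cat_simpl | exact: (Pbc_la _).1].
  elim/cat_ind: v => [|||j|j|j] // jP.
  + by move: jP; cat_simpl.
  + by cat_ldom va.
  + by cat_ldom va.
  + by cat_ldom vc.
- have := right_numg yA; case: ifP => [n_odd ->|_ []//].
  by apply: (@nle_rmove _ _ (la ord0)); [cat_simpl | exact: Pb_la_le].
- elim/cat_ind: v => [|||j|j|j]; try cat_impossible.
  + by move=> _; apply: (@nle_lmove _ _ vc); [cat_simpl | exact: (Pb_la_c j).2].
  + by move=> _; apply: (@nle_lmove _ _ va); [cat_simpl | exact: (Pb_lc_a j).2].
(* The Left option is [2n] for even [n] and [2n+1] for odd [n]; in both cases [2n+1+s(n)] is not at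
   most [z]. *)
- have [z -> zn] : exists2 z, x = numg z false &
      (z < Posz (2 * n + 1))%R || (odd n && (z == Posz (2 * n + 1))).
    have := left_numg xA; case: ifP => [n_odd ->|_ [_ ->]].
      by exists (Posz (2 * n + 1)); rewrite // eqxx orbT.
    by eexists; first reflexivity; lia.
  apply: (@nle_lmove _ _ va); first by cat_simpl.
  apply: le_posP => [v|w].
  + elim/cat_ind: v => [|||j|j|j]; try cat_impossible.
    by move=> _; apply: (nge_mono (Pba_lc j).2); rewrite le_numg; lia.
  + case/left_numg=> _ ->; apply: (@nle_lmove _ _ vc); first by cat_simpl.
    by apply: (le_trans _ Pbac.2); rewrite le_numg; lia.
Qed.

(** * Value after Left plays [a] or [c] *)

Definition gS : game := numg 0 (odd n).
Definition gE : game := numg (Posz (2 * n + 2)) (odd n.-1).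
Definition gD : game := numg (Posz (3 * n + 2)) false.
Definition gC : game := Gm [:: gD] [:: gE].
Definition gB : game := Gm [:: gC] [:: gS].
Definition gA : game := numg (Posz (2 * n + 1)) (odd n).

(** The move leaves Left [3n+2] vertices, so the result is at most [gD], the Left option of [gC]. *)
Lemma lmove_le_gD v (p : {set cat_V n} * {set cat_V n}) :
  #|p.1| = 3 * n + 3 -> v \in p.1 -> ~~ le gC (pos (lm v p)).
Proof.
move=> p3 vp; apply: (@nle_left _ _ gD); first by left.
apply: (le_trans (pos_le_card cat_adj_sym _)).
have := cardsD1 v p.1; rewrite vp p3 /= => E.
rewrite -[ofnat _]/(numg (Posz _) false) le_numg; lia.
Qed.

Lemma Pac_eqv : eqv (pos Pac) gC.
Proof.
split; [apply: pos_leP => [v|y [->|//]] | apply: le_posP => [v|x [->|//]]].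
- by apply: lmove_le_gD; cat_count.
- by apply: (@nle_rmove _ _ (lb (Ordinal n_gt0))); [cat_simpl | exact: (Pac_lb _).1].
- elim/cat_ind: v => [|||j|j|j]; try cat_impossible.
  by move=> _; apply: (@nle_right _ _ gE); [left | exact: (Pac_lb j).2].
- by apply: (@nle_lmove _ _ vb); [cat_simpl | exact: Pacb.2].
Qed.

(** After [a], continuing at [b] gains Left no more than continuing at [c]: Right answers at a leaf
    of [c] and gets down to [2n+1+s(n)], below [gE]. *)
Lemma Pab_le : le (pos Pab) gC.
Proof.
apply: pos_leP => [v|y [->|//]].
- by apply: lmove_le_gD; cat_count.
- apply: (@nle_rmove _ _ (lc ord0)); first by cat_simpl.
  by apply: (le_trans (Pab_lc _).1); rewrite le_numg; lia.
Qed.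

(** Needed when Right answers [a] at a leaf of [b]: Left's reply [c] then reaches [gE], which is no
    worse for Left than [gB]. *)
Lemma gB_le_gE : le gB gE.
Proof.
apply/leP; split=> [x [->|//]|y /right_numg].
- by apply: (@nle_right _ _ gE); [left | exact: le_refl].
- case: ifP => [_ ->|_ []//].
  by apply: (@nle_right _ _ gS); [left | rewrite le_numg; lia].
Qed.

Lemma Pa_eqv : eqv (pos Pa) gB.
Proof.
split; [apply: pos_leP => [v|y [->|//]] | apply: le_posP => [v|x [->|//]]].
- have Hb : ~~ le gB (pos Pab) by apply: (@nle_left _ _ gC); [left | exact: Pab_le].
  have Hc : ~~ le gB (pos Pac) by apply: (@nle_left _ _ gC); [left | exact: Pac_eqv.1].
  elim/cat_ind: v => [|||j|j|j] // jP.
  + by move: jP; cat_simpl.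
  + by cat_ldom vb.
  + by cat_ldom vb.
  + by cat_ldom vc.
- by apply: (@nle_rmove _ _ vc); [cat_simpl | exact: Pa_c.1].
- have Hc : ~~ le (pos (rm vc Pa)) gB by apply: (@nle_right _ _ gS); [left | exact: Pa_c.2].
  elim/cat_ind: v => [|||j|j|j] // jP; try by move: jP; cat_simpl.
  + apply: (@nle_lmove _ _ vc); first by cat_simpl.
    exact: le_trans gB_le_gE (Pa_lb_c j).2.
  + by cat_rdom vc.
- by apply: (@nle_lmove _ _ vc); [cat_simpl | exact: Pac_eqv.2].
Qed.

(** The reflection [f] exchanges [a] and [c] together with their leaves. One inequality is enough,
    since the move [a] already attains [gB]. *)
Lemma Pc_le : le (pos Pc) gB.
Proof.
pose f v : cat_V n := match v with
  | inl (inl (inl i)) => if nat_of_ord i == 0 then vc else if nat_of_ord i == 1 then vb else va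
  | inl (inl (inr i)) => lc i
  | inl (inr j) => lb j
  | inr i => la i
  end.
have fK : involutive f by elim/cat_ind.
apply: (le_trans _ Pa_eqv.1); apply: (@pos_mono _ _ cat_adj_sym f _ _ (inv_inj fK)).
- by elim/cat_ind=> [|||?|?|?]; cat_simpl.
- by elim/cat_ind=> [|||?|?|?]; cat_simpl.
- by elim/cat_ind=> [|||?|?|?]; elim/cat_ind=> [|||?|?|?].
Qed.

(** * The whole game *)

Definition gK : game := Gm [:: gA; gB] [:: negg gA; negg gB].

Lemma neg_gK : negg gK = gK.
Proof. by rewrite /gK [LHS]/= !neggK. Qed.

Lemma pos_le_gK : le (pos P0) gK.
Proof.
apply: pos_leP => [v _|y].
- have Ha : ~~ le gK (pos Pa) by apply: (@nle_left _ _ gB); [right; left | exact: Pa_eqv.1].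
  have Hb : ~~ le gK (pos Pb) by apply: (@nle_left _ _ gA); [left | exact: Pb_eqv.1].
  have Hc : ~~ le gK (pos Pc) by apply: (@nle_left _ _ gB); [right; left | exact: Pc_le].
  elim/cat_ind: v => [|||j|j|j] //.
  + by cat_ldom va.
  + by cat_ldom vb.
  + by cat_ldom vc.
(* Both players have the same open vertices at the start, so Right's moves are the negatives of
   Left's. *)
- have rmE v : pos (rm v P0) = negg (pos (lm v P0)) by rewrite pos_neg.
  case=> [->|[->|//]].
  + by apply: (@nle_rmove _ _ vb); rewrite ?inE // rmE le_neg; exact: Pb_eqv.2.
  + by apply: (@nle_rmove _ _ va); rewrite ?inE // rmE le_neg; exact: Pa_eqv.2.
Qed.

Lemma gK_eqv : eqv gK (snort (@cat_adj n)).
Proof.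
rewrite snortE; split; last exact: pos_le_gK.
have := pos_le_gK; by rewrite -le_neg neg_gK pos_neg.
Qed.

(** * Canonicity of the claimed form *)

Lemma canon_gC : canon gC.
Proof.
apply/canonE; split; [by move=> x [->|//]; exact: canon_numg
                     |by move=> x [->|//]; exact: canon_numg|split].
- exact: singleton_dominatedL.
- exact: singleton_dominatedR.
- by move=> [x [[->|//] [y [/right_numg[]]]]].
- move=> [x [[->|//] [y [yE]]]]; apply/negP; apply: (@nle_left _ _ gD); first by left.
  by move: yE => /left_numg; case: ifP => [_ ->|_ [_ ->]]; rewrite le_numg; lia.
Qed.

Lemma canon_gB : canon gB.
Proof.
apply/canonE; split; [by move=> x [->|//]; exact: canon_gC
                     |by move=> x [->|//]; exact: canon_numg|split].
- exact: singleton_dominatedL.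
- exact: singleton_dominatedR.
- move=> [x [[->|//] [y [[->|//]]]]]; apply/negP; apply: (@nle_right _ _ gS); first by left.
  by rewrite le_numg; lia.
- move=> [x [[->|//] [y [yS]]]]; apply/negP; apply: (@nle_left _ _ gC); first by left.
  (* Only odd [n] gives [gS] a Left option, namely [0]; it is at most [gC], so [gB] is not below
     it. *)
  have -> : y = numg 0 false by have := left_numg yS; case: ifP => [_ ->|_ []].
  apply/leP; split=> [z /left_numg[]//|z [->|//]].
  by rewrite le_numg; lia.
Qed.

Lemma canon_gK : canon gK.
Proof.
have AB : ~~ le gA gB.
  by apply: (@nle_right _ _ gS); [left | rewrite le_numg; lia].
(* Left moves from [gB] to [gC], and [gA <= gC]. *)
have BA : ~~ le gB gA.
  apply: (@nle_left _ _ gC); first by left.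
  apply/leP; split=> [x xA|x [->|//]].
  - apply: (@nle_left _ _ gD); first by left.
    by have := left_numg xA; case: ifP => [_ ->|_ [_ ->]]; rewrite le_numg; lia.
  - by rewrite le_numg; lia.
have no_revL : ~ reversibleL gK.
  (* Right can move from [gK] to [negg gA], which is at most [-1], so no nonnegative number is below
     [gK]. All Right options of [gA] and [gB] are such numbers, which rules out reversals. *)
  have nle_gK (z : int) b : (0 <= z)%R -> ~~ le (numg z b) gK.
    move=> z0; apply: (@nle_right _ _ (negg gA)); first by left.
    apply: (@le_trans (negg (numg 1 false))); last first.
      by rewrite -[negg _]/(numg (Negz 0) false) le_numg; lia.
    by rewrite le_neg le_numg; lia.
  move=> [x [[->|[->|//]] [y [yx]]]]; apply/negP.
  - by have := right_numg yx; case: ifP => [_ ->|_ []//]; apply: nle_gK.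
  - by case: yx => [->|//]; apply: nle_gK.
have canon_AB x : memg x [:: gA; gB] -> canon x.
  by case=> [->|[->|//]]; [exact: canon_numg | exact: canon_gB].
apply/canonE; split=> //.
  move=> x /(memg_mapg negg x [:: gA; gB])[y yAB ->].
  exact: canon_neg (canon_AB _ yAB).
split=> //.
- exact: pair_dominatedL.
- by move=> /(@dominatedR_neg [:: gA; gB]); apply: pair_dominatedL.
(* Since [gK] is its own negative, the Right side follows from the Left side. *)
- by rewrite -/gK -neg_gK => /reversibleR_neg.
Qed.
End Caterpillar.

(* The canonical form of Snort on C(n+1,n,n+1) is
   ± { 2n+1+s(n), { {3n+2 | 2n+2+s(n-1)} | s(n) } }:
   the canonical game K with this shape (each leaf being the canonical form
   of the indicated value) equals Snort on the caterpillar. *)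
Theorem theorem8 (n : nat) (hn : 1 <= n) :
  exists A B C D E S : game,
    canon (Gm [:: A; B] [:: negg A; negg B]) /\
    eqv (Gm [:: A; B] [:: negg A; negg B]) (snort (@cat_adj n)) /\
    B = Gm [:: C] [:: S] /\
    C = Gm [:: D] [:: E] /\
    eqv A (add (ofnat (2 * n + 1)) (sgame n)) /\
    eqv S (sgame n) /\
    eqv D (ofnat (3 * n + 2)) /\
    eqv E (add (ofnat (2 * n + 2)) (sgame n.-1)).
Proof.
exists (gA n), (gB n), (gC n), (gD n), (gE n), (gS n).
split; first exact: canon_gK.
split; first exact: gK_eqv.
do 2?split=> //; split; first exact: eqv_numg_add.
split; first by rewrite /gS /sgame; case: (odd n); split; apply: le_refl.
by split; [split; apply: le_refl | exact: eqv_numg_add].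
Qed.
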